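(* Let $A$ be a unital Banach algebra (over $\mathbb{R}$ or $\mathbb{C}$). Suppose that multiplication $A\times A\to A$, $(a,b)\mapsto ab$, is an open mapping. Then $A$ has topological stable rank $1$ (in symbols, ${\rm tsr}\,A=1$), i.e. the set of invertible elements of $A$ is dense in $A$.
   Context: A Banach algebra is a real or complex Banach space $A$ with an associative (bilinear) multiplication satisfying $\|ab\|\leqslant\|a\|\,\|b\|$. ${\rm GL}\,A$ denotes the set of invertible elements of a unital Banach algebra $A$; ${\rm tsr}\,A=1$ means that ${\rm GL}\,A$ is norm-dense in $A$. $B(x,r)$ is the open ball with centre $x$ and radius $r$, and for subsets $U,V\subseteq A$, $U\cdot V=\{uv\colon u\in U, v\in V\}$. Multiplication is open if it maps open subsets of $A\times A$ to open sets; equivalently, for all $x,y\in A$ and $\varepsilon>0$ there is $\delta>0$ with $B(xy,\delta)\subseteq B(x,\varepsilon)\cdot B(y,\varepsilon)$. *)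

(* Defs.v *)
From HB Require Import structures.
From mathcomp Require Import all_boot all_order all_algebra.
From mathcomp Require Import complex.
From mathcomp Require Import all_classical all_reals all_analysis.

Set Implicit Arguments.
Unset Strict Implicit.
Unset Printing Implicit Defensive.

Import Order.TTheory GRing.Theory Num.Theory.
Import numFieldNormedType.Exports.

Local Open Scope classical_set_scope.
Local Open Scope ring_scope.

(* The product is a field of this mixin, rather than inherited from
   [GRing.Algebra], because Hierarchy Builder rejects a structure joining rings
   with normed modules ([Num.NumDomain] already inherits from both rings and
   normed Z-modules). Neither 1 != 0 nor `|1| = 1 is assumed. For K = R[i] the
   norm takes its values in the nonnegative reals of R[i]. *)
HB.mixin Record CompleteNormedModule_isUnitalBanachAlgebra (K : numFieldType) A
    & CompleteNormedModule K A := {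
  bmul : A -> A -> A;
  bone : A;
  bmulA : associative bmul;
  bmul1l : left_id bone bmul;
  bmul1r : right_id bone bmul;
  bmulDl : left_distributive bmul +%R;
  bmulDr : right_distributive bmul +%R;
  bmulZl : forall (k : K) (a b : A), bmul (k *: a) b = k *: bmul a b;
  bmulZr : forall (k : K) (a b : A), bmul a (k *: b) = k *: bmul a b;
  bnormM : forall a b : A, `|bmul a b| <= `|a| * `|b|
}.

#[short(type="unitalBanachAlgType")]
HB.structure Definition UnitalBanachAlgebra (K : numFieldType) :=
  {A of CompleteNormedModule K A
      & CompleteNormedModule_isUnitalBanachAlgebra K A}.

Section BanachAlgebra.
Context (K : numFieldType) (A : unitalBanachAlgType K).

Definition GL : set A :=
  [set a | exists b : A, bmul a b = bone /\ bmul b a = bone].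

Definition open_multiplication : Prop :=
  forall U : set (A * A), open U -> open [set bmul p.1 p.2 | p in U].

Definition tsr_eq_one : Prop := dense GL.

End BanachAlgebra.

Arguments GL {K} A.
Arguments open_multiplication {K} A.
Arguments tsr_eq_one {K} A.

(* Main.v *)
(** Let [O] be a nonempty open set and [x] in [O]. The set [O * A] is open and
    contains [x * 0 = 0], hence it contains a nonzero multiple of [1], so [O]
    contains a right-invertible element; symmetrically, it contains a
    left-invertible one. Right-invertible elements form an open set, by the
    Neumann series, so the left- and right-invertible ones meet inside [O]. *)
Require Import Defs.
From mathcomp Require Import all_boot all_order all_algebra.
From mathcomp Require Import complex.
From mathcomp Require Import all_classical all_reals all_analysis.

Import Order.TTheory GRing.Theory Num.Theory.
Import numFieldNormedType.Exports.

Local Open Scope classical_set_scope.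
Local Open Scope ring_scope.
Local Open Scope complex_scope.

(* The form of the archimedean property needed for the Neumann series; it is
   isolated because [R[i]] carries no archimedean structure in the library. *)
Definition halves_vanish (K : numFieldType) : Prop :=
  forall e : K, 0 < e -> exists n : nat, 2^-1 ^+ n < e.

Lemma halves_vanish_real (R : realType) : halves_vanish R.
Proof.
move=> e e0.
have h1 : `|2^-1 : R| < 1 by rewrite ger0_norm ?invf_lt1 ?ltr1n ?invr_ge0.
have /cvgr0_norm_lt /(_ _ e0) [N _ /(_ N (leqnn N))] := cvg_expr h1.
by rewrite ger0_norm ?exprn_ge0 ?invr_ge0 // => lt; exists N.
Qed.

(** A positive element of [R[i]] is real in its partial order, so the real case applies to it. *)
Lemma halves_vanish_complex (R : realType) : halves_vanish R[i].
Proof.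
move=> e e0; have /complex_realP[k ek] : e \is Num.real by exact: gtr0_real.
move: e0; rewrite ek ltcR => /halves_vanish_real[n lt]; exists n.
suff -> : 2^-1 ^+ n = (2^-1 ^+ n : R)%:C by rewrite ltcR.
by rewrite rmorphXn fmorphV rmorph_nat.
Qed.

Section UnitalBanachAlgebra.
Context {K : numFieldType} {A : unitalBanachAlgType K}.
Implicit Types a b c u v w : A.

Let bmul0l a : bmul 0 a = 0.
Proof. by rewrite -{1}(scale0r (0 : A)) bmulZl scale0r. Qed.

Let bmul0r a : bmul a 0 = 0.
Proof. by rewrite -{1}(scale0r (0 : A)) bmulZr scale0r. Qed.

Let bmulBl a b c : bmul (a - b) c = bmul a c - bmul b c.
Proof. by rewrite -scaleN1r bmulDl bmulZl scaleN1r. Qed.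

Let bmulBr a b c : bmul a (b - c) = bmul a b - bmul a c.
Proof. by rewrite -scaleN1r bmulDr bmulZr scaleN1r. Qed.

Definition right_invertible : set A := [set a | exists b, bmul a b = bone].

Definition left_invertible : set A := [set a | exists b, bmul b a = bone].

(** The partial sums 1 + c + ... + c^n are the iterates of y |-> 1 + c y from 1. They form a Cauchy
    sequence, and the limit [l] is a fixed point: l = 1 + c l, that is, (1 - c) l = 1. *)
Lemma neumann_right_invertible c : halves_vanish K ->
  `|c| <= 2^-1 -> right_invertible (bone - c).
Proof.
move=> arch c2; pose s n := iter n (fun y => bone + bmul c y) bone.
have cM y : `|bmul c y| <= 2^-1 * `|y|.
  by rewrite (le_trans (bnormM _ _)) // ler_wpM2r.
have step n : `|s n.+1 - s n| <= 2^-1 ^+ n.+1 * `|bone : A|.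
  elim: n => [|n ih]; first by rewrite /= addrC addKr.
  have -> : s n.+2 - s n.+1 = bmul c (s n.+1 - s n).
    by rewrite /= opprD addrACA subrr add0r -bmulBr.
  by rewrite (le_trans (cM _)) // exprS -mulrA ler_wpM2l // invr_ge0.
(* The factor is the exact value of the geometric sum of 2^-(j+1) over n <= j < n + k, so the
   induction on [k] closes without loss. *)
have dist n k :
    `|s (n + k)%N - s n| <= (2^-1 ^+ n - 2^-1 ^+ (n + k)) * `|bone : A|.
  elim: k => [|k ih]; first by rewrite addn0 !subrr normr0 mul0r.
  rewrite addnS (le_trans (ler_distD (s (n + k)%N) _ _)) //.
  rewrite (le_trans (lerD (step _) ih)) // -mulrDl ler_wpM2r //.
  rewrite addrCA lerD2l -[X in _ - X]mul1r exprS -mulrBl -mulNr ler_wpM2r //.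
  by rewrite [X in _ - X](splitr 1) mul1r opprD addNKr.
(* Adding 1 keeps the divisor positive even in the zero algebra, where 1 has norm 0. *)
have n1 : 0 < `|bone : A| + 1 by rewrite ltr_wpDl.
have /cauchy_cvgP/cvg_ex[l sl] : cauchy (s @ \oo).
  apply: cauchy_exP => e e0.
  have [N ltN] := arch (e / (`|bone : A| + 1)) (divr_gt0 e0 n1).
  exists (s N); exists N => // n /= /subnKC <-.
  rewrite -ball_normE /= distrC (le_lt_trans (dist _ _)) //.
  rewrite ltr_pdivlMr // in ltN; apply: le_lt_trans ltN.
  rewrite ler_pM // ?lerDl ?gerBl ?exprn_ge0 ?invr_ge0 // subr_ge0.
  by rewrite exprD ler_piMr ?exprn_ile1 ?exprn_ge0 ?invr_ge0 ?invf_le1 ?ler1n.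
have cl : (fun n => bone + bmul c (s n)) @ \oo --> bone + bmul c l.
  apply: cvgD; first exact: cvg_cst.
  apply/cvgrPdist_lt => e e0; move/cvgrPdist_lt: sl => /(_ e e0).
  apply: filterS => n; apply: le_lt_trans.
  by rewrite -bmulBr (le_trans (cM _)) // ler_piMl // invf_le1 ?ler1n.
(* The sequence in [cl] is [s] shifted by one index, so it also tends to [l]. *)
have lE : l = bone + bmul c l.
  apply: (cvg_unique _ _ cl); first exact: norm_hausdorff.
  by have := sl; rewrite -cvg_shiftS.
by exists l; rewrite bmulBl bmul1l [X in X - _]lE addrK.
Qed.

(** If u v = 1, then w v = 1 - (u - w) v, and the radius makes the last term at most 1/2 in norm. A
    right inverse [y] of w v yields the right inverse v y of [w]. *)
Lemma open_right_invertible : halves_vanish K -> open right_invertible.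
Proof.
move=> arch; rewrite openE => u [v uv1]; apply/nbhs_ballP.
have v1 : 0 < `|v| + 1 by rewrite ltr_wpDl.
exists (2^-1 / (`|v| + 1)) => [|w].
  by rewrite /= divr_gt0 ?invr_gt0.
rewrite -ball_normE /= => /ltW uw.
have : right_invertible (bone - bmul (u - w) v).
  apply: neumann_right_invertible => //.
  rewrite (le_trans (bnormM _ _)) // (le_trans (ler_wpM2r _ uw)) //.
  rewrite -mulrA ler_piMr ?invr_ge0 // ler_pdivrMl // mulr1.
  by rewrite lerDl.
by rewrite bmulBl uv1 subKr => -[y wvy]; exists (bmul v y); rewrite bmulA.
Qed.

Lemma nbhs0_scaled_bone (V : set A) :
  nbhs 0 V -> exists2 t : K, t != 0 & V (t *: bone).
Proof.
move=> /nbhs_ballP[d /= d0 dV].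
have n1 : 0 < `|bone : A| + 1 by rewrite ltr_wpDl.
exists (d / (`|bone : A| + 1)); first by rewrite gt_eqF // divr_gt0.
apply: dV; rewrite -ball_normE /= sub0r normrN normrZ gtr0_norm ?divr_gt0 //.
by rewrite -mulrA gtr_pMr // ltr_pdivrMl // mulr1 ltrDl.
Qed.

Lemma open_mul_dense_right_invertible :
  open_multiplication A -> dense right_invertible.
Proof.
move=> om O [x Ox] oO.
have /om : open (fst @^-1` O : set (A * A)).
  by apply: open_comp => // p _; exact: cvg_fst.
rewrite openE => /(_ 0) om0.
(* Here u v = t 1 with [u] in [O]; dividing [v] by the nonzero scalar [t] gives a right inverse of
   [u]. *)
have /nbhs0_scaled_bone[t t0 [[u v] /= Ou uv]] := om0 (ex_intro2 _ _ (x, 0) Ox (bmul0r x)).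
by exists u; split=> //; exists (t^-1 *: v); rewrite bmulZr uv scalerK.
Qed.

Lemma open_mul_dense_left_invertible :
  open_multiplication A -> dense left_invertible.
Proof.
move=> om O [x Ox] oO.
have /om : open (snd @^-1` O : set (A * A)).
  by apply: open_comp => // p _; exact: cvg_snd.
rewrite openE => /(_ 0) om0.
have /nbhs0_scaled_bone[t t0 [[v u] /= Ou vu]] := om0 (ex_intro2 _ _ (0, x) Ox (bmul0l x)).
by exists u; split=> //; exists (t^-1 *: v); rewrite bmulZl vu scalerK.
Qed.

Lemma open_mul_tsr_eq_one :
  halves_vanish K -> open_multiplication A -> tsr_eq_one A.
Proof.
move=> arch om O O0 oO.
have oR := open_right_invertible arch.
have OR0 := open_mul_dense_right_invertible om O O0 oO.
have [u [[Ou [v uv]] [w wu]]] :=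
  open_mul_dense_left_invertible om _ OR0 (openI oO oR).
(* The one-sided inverses agree: v = (w u) v = w (u v) = w. *)
have vw : v = w by rewrite -[v]bmul1l -wu -bmulA uv bmul1r.
by exists u; split=> //; exists v; rewrite [X in bmul X u]vw.
Qed.

End UnitalBanachAlgebra.

Theorem proposition4p1 (R : realType) :
  (forall A : unitalBanachAlgType R,
     open_multiplication A -> tsr_eq_one A) /\
  (forall A : unitalBanachAlgType R[i],
     open_multiplication A -> tsr_eq_one A).
Proof.
split=> A; apply: open_mul_tsr_eq_one.
  exact: halves_vanish_real.
exact: halves_vanish_complex.
Qed.
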